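(* Let $n > 3$ be an integer, let $j = 2n-3$, and let $N = n^2 + j = n^2+2n-3$. If $n$ is odd, then the length of the period of the continued fraction of $\sqrt{N}$ is $4$ and $\sqrt{N} = [n, \overline{1, \tfrac{n-3}{2}, 1, 2n}]$. If $n$ is even, then the length of the period is $6$ and $\sqrt{N} = [n, \overline{1, \tfrac{n}{2}-1, 2, \tfrac{n}{2}-1, 1, 2n}]$.
   Context: The (simple) continued fraction expansion of an irrational real number $x$ is the unique infinite sequence $[a_0,a_1,a_2,\dots]$ with $a_0\in\mathbb Z$ and $a_i$ a positive integer for $i\ge 1$, such that the convergents $a_0+\cfrac{1}{a_1+\cfrac{1}{\ddots+\cfrac{1}{a_m}}}$ converge to $x$ as $m\to\infty$. The notation $[a_0,\dots,a_k,\overline{a_{k+1},\dots,a_\ell}]$ means that the block $a_{k+1},\dots,a_\ell$ is repeated infinitely many times after the preperiod $a_0,\dots,a_k$. The length of the period is the number of entries in the shortest repeating block. *)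

(* Defs.v *)
From Stdlib Require Import Reals ZArith List Lia.
From Coquelicot Require Import Coquelicot.
Import ListNotations.

Open Scope R_scope.

(* a_0 + 1/(a_1 + 1/(... + 1/a_m)).  Stdlib's convention for / 0 is
   irrelevant below, since all partial quotients after a_0 are positive. *)
Fixpoint convergent (a : nat -> Z) (m : nat) : R :=
  match m with
  | O => IZR (a O)
  | S m' => IZR (a O) + 1 / convergent (fun i => a (S i)) m'
  end.

Definition simple_cf (x : R) (a : nat -> Z) : Prop :=
  (forall i : nat, (1 <= i)%nat -> (0 < a i)%Z) /\
  is_lim_seq (convergent a) x.

(* Uniqueness is part of the definition; sequences are compared pointwise. *)
Definition is_cf_expansion (x : R) (a : nat -> Z) : Prop :=
  simple_cf x a /\
  forall b : nat -> Z, simple_cf x b -> forall i : nat, b i = a i.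

(* The infinite sequence pre, per, per, per, ...; the default value 0 of nth
   is never used when per is nonempty. *)
Definition eventually_periodic_seq (pre per : list Z) (i : nat) : Z :=
  if (i <? length pre)%nat then nth i pre 0%Z
  else nth ((i - length pre) mod length per) per 0%Z.

(* From some index on, a is the repetition of a block with p entries. *)
Definition has_repeating_block (a : nat -> Z) (p : nat) : Prop :=
  (0 < p)%nat /\
  exists k : nat, forall i : nat, (k <= i)%nat -> a (i + p)%nat = a i.

Definition period_length (a : nat -> Z) (p : nat) : Prop :=
  has_repeating_block a p /\
  forall q : nat, has_repeating_block a q -> (p <= q)%nat.

Definition cf_period_length (x : R) (p : nat) : Prop :=
  exists a : nat -> Z, is_cf_expansion x a /\ period_length a p.

(* Main.v *)
Require Import Defs.
From Stdlib Require Import Reals ZArith Lra Lia List.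
From Coquelicot Require Import Coquelicot.
Import ListNotations.
Open Scope R_scope.

(** Write [x = x_0] and [x_i = a_i + 1 / x_(i+1)] with all [x_(i+1)] positive.
    Since [x_i * x_(i+1) = a_i * x_(i+1) + 1 >= 2] for [i >= 1], likewise for
    convergents, the error of a convergent shrinks by a factor 4 every two
    steps, so the convergents tend to [x].  Conversely, an infinite expansion
    of [x] forces [a_0 < x < a_0 + 1] and its tail expands [1 / (x - a_0)], so
    it is unique.  For [sqrt N] the complete quotients are [(sqrt N + P) / Q];
    they return to their first value after 4 (resp. 6) steps.  The entry [2n]
    occurs only once in the block, so no shorter block repeats. *)

(** * Bounds on convergents and the contraction estimate *)

Definition shift (a : nat -> Z) (i : nat) : Z := a (S i).

Lemma convergent_S (a : nat -> Z) (m : nat) :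
  convergent a (S m) = IZR (a O) + 1 / convergent (shift a) m.
Proof. reflexivity. Qed.

Lemma inv_ge1_bounds (u : R) : 1 <= u -> 0 < 1 / u <= 1.
Proof.
  intros hu. split.
  - apply Rdiv_lt_0_compat; lra.
  - apply Rle_div_l; lra.
Qed.

Lemma IZR_pos_ge1 (z : Z) : (0 < z)%Z -> 1 <= IZR z.
Proof. intros hz. apply IZR_le. lia. Qed.

Lemma convergent_ge (a : nat -> Z) (m : nat) :
  (forall i, (1 <= i)%nat -> (0 < a i)%Z) -> IZR (a O) <= convergent a m.
Proof.
  revert a; induction m as [|m IH]; intros a ha; [simpl; lra|].
  rewrite convergent_S.
  assert (h : IZR (shift a 0) <= convergent (shift a) m)
    by (apply IH; intros i _; apply ha; lia).
  assert (h1 : 1 <= IZR (shift a 0)) by (apply IZR_pos_ge1, ha; lia).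
  destruct (inv_ge1_bounds (convergent (shift a) m)); lra.
Qed.

Lemma convergent_le (a : nat -> Z) (m : nat) :
  (forall i, (1 <= i)%nat -> (0 < a i)%Z) -> convergent a m <= IZR (a O) + 1.
Proof.
  intros ha. destruct m as [|m]; [simpl; lra|].
  rewrite convergent_S.
  assert (h : IZR (shift a 0) <= convergent (shift a) m)
    by (apply convergent_ge; intros i _; apply ha; lia).
  assert (h1 : 1 <= IZR (shift a 0)) by (apply IZR_pos_ge1, ha; lia).
  destruct (inv_ge1_bounds (convergent (shift a) m)); lra.
Qed.

(** The difference is [(u - v) / ((a * u + 1) * (a * v + 1))], and each factor of the denominator is
    at least 2. Two steps are taken at once because [u -> 1 / u] alone need not contract near 1. *)
Lemma inv_iter_contracts (a u v : R) :
  1 <= a -> 1 <= u -> 1 <= v ->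
  Rabs (1 / (a + 1 / u) - 1 / (a + 1 / v)) <= Rabs (u - v) / 4.
Proof.
  intros ha hu hv.
  replace (1 / (a + 1 / u) - 1 / (a + 1 / v))
    with ((u - v) / ((a * u + 1) * (a * v + 1))).
  2:{ field. repeat split; nra. }
  assert (h : 4 <= (a * u + 1) * (a * v + 1)).
  { assert (2 <= a * u + 1) by nra. assert (2 <= a * v + 1) by nra. nra. }
  unfold Rdiv. rewrite Rabs_mult, Rabs_inv.
  apply Rmult_le_compat_l; [apply Rabs_pos|].
  rewrite (Rabs_pos_eq ((a * u + 1) * (a * v + 1))) by lra.
  apply Rinv_le_contravar; lra.
Qed.

(** * Convergence from a sequence of complete quotients *)

Section CompleteQuotients.

Variables (a : nat -> Z) (x : nat -> R).
Hypothesis a_pos : forall i, (1 <= i)%nat -> (0 < a i)%Z.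
Hypothesis x_pos : forall i, 0 < x (S i).
Hypothesis x_step : forall i, x i = IZR (a i) + 1 / x (S i).

Let tail (i : nat) : nat -> Z := fun k => a (i + k)%nat.

Lemma shift_tail (i k : nat) : tail i (S k) = tail (S i) k.
Proof. unfold tail. f_equal. lia. Qed.

Lemma convergent_ext (b c : nat -> Z) (m : nat) :
  (forall k, b k = c k) -> convergent b m = convergent c m.
Proof.
  revert b c; induction m as [|m IH]; intros b c h; simpl; rewrite h; [easy|].
  do 2 f_equal. apply IH. intros k; apply h.
Qed.

Lemma convergent_tail_S (i m : nat) :
  convergent (tail i) (S m) = IZR (a i) + 1 / convergent (tail (S i)) m.
Proof.
  rewrite convergent_S.
  rewrite (convergent_ext (shift (tail i)) (tail (S i)) m (shift_tail i)).
  unfold tail. now rewrite Nat.add_0_r.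
Qed.

Lemma convergent_tail_ge1 (i m : nat) : 1 <= convergent (tail (S i)) m.
Proof.
  apply Rle_trans with (IZR (tail (S i) 0)).
  - apply IZR_pos_ge1, a_pos; lia.
  - apply convergent_ge. intros k _. apply a_pos; lia.
Qed.

Lemma complete_quotient_ge1 (i : nat) : 1 <= x (S i).
Proof.
  rewrite x_step.
  assert (h : 1 <= IZR (a (S i))) by (apply IZR_pos_ge1, a_pos; lia).
  assert (0 < 1 / x (S (S i))) by (apply Rdiv_lt_0_compat; [lra|apply x_pos]).
  lra.
Qed.

Lemma convergent_error_le (m : nat) :
  forall i, Rabs (x i - convergent (tail i) m) <= 2 * (1 / 2) ^ m.
Proof.
  (* The contraction advances two steps at a time, so the induction carries two consecutive depths;
     a factor 1/4 per two steps is the rate 1/2 per step. *)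
  enough (h : forall i,
    Rabs (x i - convergent (tail i) m) <= 2 * (1 / 2) ^ m /\
    Rabs (x i - convergent (tail i) (S m)) <= 2 * (1 / 2) ^ S m)
    by (intros i; apply h).
  induction m as [|m IH]; intros i.
  - split.
    + rewrite x_step. simpl. unfold tail. rewrite Nat.add_0_r.
      destruct (inv_ge1_bounds (x (S i)) (complete_quotient_ge1 i)).
      rewrite Rabs_pos_eq; lra.
    + rewrite convergent_tail_S, x_step.
      destruct (inv_ge1_bounds _ (complete_quotient_ge1 i)).
      destruct (inv_ge1_bounds _ (convergent_tail_ge1 i 0)).
      simpl pow. apply Rabs_le. lra.
  - split; [apply IH|].
    rewrite !convergent_tail_S, (x_step i), (x_step (S i)).
    replace (IZR (a i) + 1 / (IZR (a (S i)) + 1 / x (S (S i))) -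
      (IZR (a i) + 1 / (IZR (a (S i)) + 1 / convergent (tail (S (S i))) m)))
      with (1 / (IZR (a (S i)) + 1 / x (S (S i))) -
        1 / (IZR (a (S i)) + 1 / convergent (tail (S (S i))) m)) by ring.
    apply Rle_trans with (Rabs (x (S (S i)) - convergent (tail (S (S i))) m) / 4).
    + apply inv_iter_contracts.
      * apply IZR_pos_ge1, a_pos; lia.
      * apply complete_quotient_ge1.
      * apply convergent_tail_ge1.
    + destruct (IH (S (S i))) as [h _]. simpl pow in *. lra.
Qed.

Lemma simple_cf_complete_quotients : simple_cf (x 0%nat) a.
Proof.
  split; [exact a_pos|].
  apply is_lim_seq_spec. intros eps.
  assert (hg : is_lim_seq (fun m => 2 * (1 / 2) ^ m) 0).
  { replace (Finite 0) with (Rbar_mult 2 0) by (simpl; f_equal; ring).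
    apply is_lim_seq_scal_l, is_lim_seq_geom. rewrite Rabs_pos_eq; lra. }
  apply is_lim_seq_spec in hg. destruct (hg eps) as [M hM].
  exists M. intros m hm.
  rewrite Rabs_minus_sym.
  eapply Rle_lt_trans; [apply (convergent_error_le m 0)|].
  eapply Rle_lt_trans; [|apply (hM m hm)].
  rewrite Rminus_0_r. apply Rle_abs.
Qed.

End CompleteQuotients.

(** * Uniqueness of the expansion *)

Lemma simple_cf_tail (x : R) (b : nat -> Z) :
  simple_cf x b -> IZR (b O) < x /\ simple_cf (1 / (x - IZR (b O))) (shift b).
Proof.
  intros [hb hl].
  assert (hs : forall i, (1 <= i)%nat -> (0 < shift b i)%Z)
    by (intros i _; apply hb; lia).
  assert (h1 : 1 <= IZR (shift b 0)) by (apply IZR_pos_ge1, hb; lia).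
  assert (hl1 : is_lim_seq (fun m => convergent b (S m)) x)
    by (apply -> is_lim_seq_incr_1; exact hl).
  (* The tail's convergents are bounded, so x stays away from b_0. *)
  assert (hx : IZR (b O) + 1 / (IZR (shift b 0) + 1) <= x).
  { refine (is_lim_seq_le (fun _ => IZR (b O) + 1 / (IZR (shift b 0) + 1)) _
      (Finite _) (Finite _) _ (is_lim_seq_const _) hl1).
    intros m. rewrite convergent_S. apply Rplus_le_compat_l.
    unfold Rdiv. rewrite !Rmult_1_l.
    pose proof (convergent_ge _ m hs).
    apply Rinv_le_contravar; [lra|]. apply convergent_le, hs. }
  assert (hx0 : IZR (b O) < x).
  { assert (0 < 1 / (IZR (shift b 0) + 1)) by (apply Rdiv_lt_0_compat; lra).
    lra. }
  split; [exact hx0|]. split; [exact hs|].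
  (* Solving the recursion for the tail's convergent expresses it through that of [b]; inversion
     passes to the limit because [x] differs from [b O]. *)
  apply is_lim_seq_ext with (fun m => / (convergent b (S m) - IZR (b O))).
  - intros m. rewrite convergent_S. pose proof (convergent_ge _ m hs).
    field. lra.
  - unfold Rdiv. rewrite Rmult_1_l.
    change (Finite (/ (x - IZR (b O)))) with (Rbar_inv (x - IZR (b O))).
    apply is_lim_seq_inv.
    + apply is_lim_seq_minus'; [exact hl1|apply is_lim_seq_const].
    + intros h. injection h. lra.
Qed.

(** The upper bound is strict because the lower bound, applied to the tail, gives
    [1 / (x - b_0) > b_1 >= 1]. *)
Lemma simple_cf_head_bounds (x : R) (b : nat -> Z) :
  simple_cf x b -> IZR (b O) < x < IZR (b O) + 1.
Proof.
  intros h. destruct (simple_cf_tail _ _ h) as [h0 ht].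
  split; [exact h0|].
  destruct (simple_cf_tail _ _ ht) as [h1 _].
  assert (1 <= IZR (shift b 0)) by (apply IZR_pos_ge1, h; lia).
  assert (hlt : 1 < 1 / (x - IZR (b O))) by lra.
  apply Rlt_div_r in hlt; lra.
Qed.

(** The head is the floor of [x], so both heads agree; both tails then expand the same number, and
    induction on the index applies. *)
Lemma simple_cf_unique (x : R) (a b : nat -> Z) :
  simple_cf x a -> simple_cf x b -> forall i, b i = a i.
Proof.
  intros ha hb i. revert x a b ha hb.
  induction i as [|i IH]; intros x a b ha hb.
  all: assert (h0 : b O = a O) by
    (destruct (simple_cf_head_bounds _ _ ha) as [a1 a2];
     destruct (simple_cf_head_bounds _ _ hb) as [b1 b2];
     assert (b O < a O + 1)%Z by (apply lt_IZR; rewrite plus_IZR; lra);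
     assert (a O < b O + 1)%Z by (apply lt_IZR; rewrite plus_IZR; lra);
     lia).
  - exact h0.
  - destruct (simple_cf_tail _ _ ha) as [_ ta].
    destruct (simple_cf_tail _ _ hb) as [_ tb].
    rewrite h0 in tb. exact (IH _ _ _ ta tb).
Qed.

Lemma simple_cf_is_cf_expansion (x : R) (a : nat -> Z) :
  simple_cf x a -> is_cf_expansion x a.
Proof. intros h. split; [exact h|]. intros b. now apply simple_cf_unique. Qed.

(** * Periodic expansions from a fixed point *)

Definition cf_cons (a : Z) (t : R) : R := IZR a + 1 / t.

Lemma fold_right_cf_cons_pos (l : list Z) (t : R) :
  List.Forall (fun z => (0 < z)%Z) l -> 0 < t -> 0 < fold_right cf_cons t l.
Proof.
  intros hl ht. induction hl as [|z l hz hl IH]; simpl; [exact ht|].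
  unfold cf_cons at 1. apply IZR_pos_ge1 in hz.
  assert (0 < 1 / fold_right cf_cons t l) by (apply Rdiv_lt_0_compat; lra).
  lra.
Qed.

Lemma skipn_nth_cons (l : list Z) (r : nat) :
  (r < length l)%nat -> skipn r l = nth r l 0%Z :: skipn (S r) l.
Proof.
  revert r; induction l as [|z l IH]; intros [|r] h; simpl in h; try lia.
  - reflexivity.
  - simpl. rewrite IH by lia. reflexivity.
Qed.

(** The complete quotients are the folds over the suffixes of [per], ending in [t]; the fixed-point
    equation closes the cycle. *)
Lemma simple_cf_periodic (a0 : Z) (per : list Z) (t : R) :
  per <> [] -> List.Forall (fun z => (0 < z)%Z) per -> 0 < t ->
  fold_right cf_cons t per = t ->
  simple_cf (cf_cons a0 t) (eventually_periodic_seq [a0] per).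
Proof.
  intros hne hpos ht hfix.
  assert (hlen : length per <> 0%nat) by (destruct per; [easy|simpl; lia]).
  set (y := fun r => fold_right cf_cons t (skipn r per)).
  set (x := fun i => match i with
                     | O => cf_cons a0 t
                     | S k => y (k mod length per)%nat
                     end).
  assert (hseq : forall k, eventually_periodic_seq [a0] per (S k) =
                   nth (k mod length per) per 0%Z).
  { intros k. unfold eventually_periodic_seq. simpl length.
    replace (S k <? 1)%nat with false by (symmetry; apply Nat.ltb_ge; lia).
    do 2 f_equal. lia. }
  assert (hmod : forall k, (k mod length per < length per)%nat)
    by (intros k; now apply Nat.mod_upper_bound).
  change (cf_cons a0 t) with (x 0%nat).
  apply simple_cf_complete_quotients.
  - intros [|i] hi; [lia|]. rewrite hseq.
    rewrite Forall_forall in hpos. apply hpos, nth_In, hmod.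
  - intros i. apply fold_right_cf_cons_pos; [|exact ht].
    rewrite <- (firstn_skipn (i mod length per) per) in hpos.
    now apply Forall_app in hpos.
  - intros [|k].
    + simpl x. rewrite Nat.Div0.mod_0_l. unfold y. simpl skipn. rewrite hfix.
      reflexivity.
    + rewrite hseq. unfold x.
      set (r := (k mod length per)%nat).
      assert (hr : (r < length per)%nat) by apply hmod.
      unfold y at 1. rewrite skipn_nth_cons by exact hr.
      change (cf_cons (nth r per 0%Z) (y (S r)) =
              IZR (nth r per 0%Z) + 1 / y (S k mod length per)%nat).
      unfold cf_cons. do 2 f_equal.
      replace (S k mod length per)%nat with (S r mod length per)%nat.
      2:{ unfold r. rewrite <- (Nat.add_1_r k), <- (Nat.add_1_r (k mod length per)).
          apply Nat.Div0.add_mod_idemp_l. }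
      (* At the end of the block the suffix is empty and folds to [t], while index 0 gives the full
         block: [hfix] identifies the two. *)
      destruct (Nat.eq_dec (S r) (length per)) as [e|e].
      * rewrite e, Nat.Div0.mod_same. unfold y. simpl skipn.
        rewrite skipn_all. symmetry. exact hfix.
      * rewrite Nat.mod_small by lia. reflexivity.
Qed.

(** * Minimality of the period *)

Lemma eventually_periodic_seq_add (pre per : list Z) (i : nat) :
  eventually_periodic_seq pre per (length pre + i) =
  nth (i mod length per) per 0%Z.
Proof.
  unfold eventually_periodic_seq.
  replace (length pre + i <? length pre)%nat with false
    by (symmetry; apply Nat.ltb_ge; lia).
  do 2 f_equal. lia.
Qed.

(** An entry found only at position [r] of the block recurs exactly at positions congruent to [r],
    so [r + q] is congruent to [r] modulo the block length, which excludes [0 < q < length per]. *)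
Lemma period_length_unique_entry (pre per : list Z) (r : nat) :
  (r < length per)%nat ->
  (forall i, (i < length per)%nat -> nth i per 0%Z = nth r per 0%Z -> i = r) ->
  period_length (eventually_periodic_seq pre per) (length per).
Proof.
  intros hr huniq. split; [split; [lia|]|].
  - exists (length pre). intros i hi.
    replace i with (length pre + (i - length pre))%nat by lia.
    rewrite <- Nat.add_assoc, !eventually_periodic_seq_add.
    f_equal. rewrite <- (Nat.mul_1_l (length per)) at 1.
    apply Nat.Div0.mod_add.
  - intros q [hq [k hk]].
    (* This index is at least [k], as the block is nonempty, and falls on position [r]. *)
    specialize (hk (length pre + (r + k * length per))%nat ltac:(nia)).
    rewrite <- Nat.add_assoc, !eventually_periodic_seq_add in hk.
    rewrite Nat.Div0.mod_add, (Nat.mod_small r) in hk by exact hr.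
    apply huniq in hk; [|apply Nat.mod_upper_bound; lia].
    replace (r + k * length per + q)%nat with (r + q + k * length per)%nat
      in hk by lia.
    rewrite Nat.Div0.mod_add in hk.
    destruct (Nat.le_gt_cases (length per) q) as [h|h]; [exact h|].
    exfalso.
    destruct (Nat.lt_ge_cases (r + q) (length per)) as [h'|h'].
    + rewrite Nat.mod_small in hk by exact h'. lia.
    + replace (r + q)%nat with (r + q - length per + 1 * length per)%nat
        in hk by lia.
      rewrite Nat.Div0.mod_add, Nat.mod_small in hk by lia. lia.
Qed.

(** * Quadratic complete quotients and the square root *)

Lemma cf_cons_quadratic (a : Z) (s P Q P' Q' : R) :
  0 < Q -> 0 < Q' -> 0 < s + P ->
  Q * Q' = s * s - P * P -> P' = IZR a * Q' - P ->
  cf_cons a ((s + P) / Q) = (s + P') / Q'.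
Proof.
  intros hQ hQ' hs h ->. unfold cf_cons.
  (* Rationalising the denominator. This is the classical recurrence for complete quotients of a
     square root, read backwards: [(P', Q')] precedes [(P, Q)]. *)
  replace (1 / ((s + P) / Q)) with ((s - P) / Q').
  - field. lra.
  - apply (Rmult_eq_reg_r (Q' * (s + P)));
      [|apply Rgt_not_eq, Rmult_lt_0_compat; lra].
    transitivity ((s - P) * (s + P)); [field; lra|].
    transitivity (Q * Q'); [lra|field; lra].
Qed.

Ltac side_condition :=
  rewrite ?mult_IZR;
  match goal with
  | hss : ?s * ?s = _, hnk : IZR _ = _ |- _ = ?s * ?s - _ =>
      rewrite hss, hnk; ring
  | _ => lra
  end.

Theorem mainTheorem5 (n j N : Z) (hn : (n > 3)%Z)
  (hj : j = (2 * n - 3)%Z) (hN : N = (n ^ 2 + j)%Z) :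
  (Z.Odd n ->
     cf_period_length (sqrt (IZR N)) 4 /\
     is_cf_expansion (sqrt (IZR N))
       (eventually_periodic_seq [n] [1; (n - 3) / 2; 1; 2 * n]%Z)) /\
  (Z.Even n ->
     cf_period_length (sqrt (IZR N)) 6 /\
     is_cf_expansion (sqrt (IZR N))
       (eventually_periodic_seq [n]
          [1; n / 2 - 1; 2; n / 2 - 1; 1; 2 * n]%Z)).
Proof.
  assert (hn4 : 4 <= IZR n) by (apply IZR_le; lia).
  assert (hNR : IZR N = IZR n * IZR n + 2 * IZR n - 3).
  { replace N with (n * n + 2 * n - 3)%Z by nia.
    rewrite minus_IZR, plus_IZR, !mult_IZR. reflexivity. }
  set (s := sqrt (IZR N)).
  assert (hss : s * s = IZR n * IZR n + 2 * IZR n - 3)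
    by (unfold s; rewrite sqrt_sqrt; nra).
  assert (hs0 : 0 <= s) by apply sqrt_pos.
  assert (ht : 0 < (s + IZR n) / (2 * IZR n - 3))
    by (apply Rdiv_lt_0_compat; lra).
  (* Here [s] is read as [(s + 0) / 1], and [2n - 3] is [N - n^2]. *)
  assert (hhead : cf_cons n ((s + IZR n) / (2 * IZR n - 3)) = s).
  { rewrite (cf_cons_quadratic n s _ _ 0 1) by lra. field. }
  split.
  - intros [m hm].
    set (k := (m - 1)%Z). replace ((n - 3) / 2)%Z with k
      by (apply Z.div_unique with 0%Z; lia).
    assert (hk : (1 <= k)%Z) by lia.
    assert (hnk : IZR n = 2 * IZR k + 3).
    { replace n with (2 * k + 3)%Z by lia. rewrite plus_IZR, mult_IZR. reflexivity. }
    assert (hkR : 1 <= IZR k) by (apply IZR_le; lia).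
    assert (hexp : is_cf_expansion s
      (eventually_periodic_seq [n] [1; k; 1; 2 * n]%Z)).
    { apply simple_cf_is_cf_expansion.
      rewrite <- hhead at 1. apply simple_cf_periodic; [easy| |exact ht|].
      { repeat constructor; lia. }
      simpl fold_right.
      (* The fold is evaluated from the inside, so the block is traversed from its last entry to its
         first. In terms of [k], [2n - 3] is [4k + 3]. *)
      rewrite (cf_cons_quadratic (2 * n) s _ _ (IZR n) 1)
        by side_condition.
      rewrite (cf_cons_quadratic 1 s _ _ (2 * IZR k) (4 * IZR k + 3)) by side_condition.
      rewrite (cf_cons_quadratic k s _ _ (2 * IZR k) 4) by side_condition.
      rewrite (cf_cons_quadratic 1 s _ _ (IZR n) (2 * IZR n - 3)) by side_condition.
      reflexivity. }
    split; [|exact hexp].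
    eexists; split; [exact hexp|].
    (* Position 3 holds [2n], which exceeds every other entry. *)
    apply (period_length_unique_entry [n] [1; k; 1; 2 * n]%Z 3); simpl length; [lia|].
    intros [|[|[|[|i]]]] hi; cbn [nth]; lia.
  - intros [m hm].
    set (k := (m - 1)%Z). replace (n / 2 - 1)%Z with k
      by (replace (n / 2)%Z with m by (apply Z.div_unique with 0%Z; lia); lia).
    assert (hk : (1 <= k)%Z) by lia.
    assert (hnk : IZR n = 2 * IZR k + 2).
    { replace n with (2 * k + 2)%Z by lia. rewrite plus_IZR, mult_IZR. reflexivity. }
    assert (hkR : 1 <= IZR k) by (apply IZR_le; lia).
    assert (hexp : is_cf_expansion s
      (eventually_periodic_seq [n] [1; k; 2; k; 1; 2 * n]%Z)).
    { apply simple_cf_is_cf_expansion.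
      rewrite <- hhead at 1. apply simple_cf_periodic; [easy| |exact ht|].
      { repeat constructor; lia. }
      simpl fold_right.
      (* Again from the last entry backwards, now with [2n - 3 = 4k + 1]. At the middle entry 2 the
         value [P = 2k + 1] is unchanged, which reflects the symmetry of the block before [2n]. *)
      rewrite (cf_cons_quadratic (2 * n) s _ _ (IZR n) 1)
        by side_condition.
      rewrite (cf_cons_quadratic 1 s _ _ (2 * IZR k - 1) (4 * IZR k + 1)) by side_condition.
      rewrite (cf_cons_quadratic k s _ _ (2 * IZR k + 1) 4) by side_condition.
      rewrite (cf_cons_quadratic 2 s _ _ (2 * IZR k + 1) (2 * IZR k + 1)) by side_condition.
      rewrite (cf_cons_quadratic k s _ _ (2 * IZR k - 1) 4) by side_condition.
      rewrite (cf_cons_quadratic 1 s _ _ (IZR n) (2 * IZR n - 3)) by side_condition.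
      reflexivity. }
    split; [|exact hexp].
    eexists; split; [exact hexp|].
    apply (period_length_unique_entry [n] [1; k; 2; k; 1; 2 * n]%Z 5); simpl length; [lia|].
    intros [|[|[|[|[|[|i]]]]]] hi; cbn [nth]; lia.
Qed.
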